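(* Let $T\rtimes R$ be a semidirect product of finite $2$-groups with $T$ normal and $R$ abelian, write $TR=T\rtimes R$, let $n\ge1$, and let $S(T,R,J)$ be the associated group of $n\times n$ monomial matrices over $TR$ (defined in the context). Then $r_2(S(T,R,J))\le n\cdot r_2(T)+(n-1)\,r_2(R)$.
   Context: For a finite $2$-group $P$, $r_2(P)$ is the maximal dimension over $\mathbb Z_2$ of an elementary abelian subgroup of $P$. Matrices below are monomial matrices with nonzero entries in the group $TR$, multiplied in the usual way. For $r\in R$ let $d_k(r)$ be the $2^k\times2^k$ diagonal matrix $\mathrm{diag}(r,1,\dots,1)$, and $d_0(r)=(r)$. Define $w_0(T,R,J)=T$ and, inductively, let $w_{k+1}(T,R,J)$ be the group of $2^{k+1}\times2^{k+1}$ matrices generated by all $\mathrm{diag}(a,I_{2^k})$ and $\mathrm{diag}(I_{2^k},a)$ with $a\in w_k(T,R,J)$, all $\mathrm{diag}(d_k(r),d_k(r)^{-1})$ with $r\in R$, and the permutation matrix $\begin{pmatrix}0&I_{2^k}\\ I_{2^k}&0\end{pmatrix}$. Let $n=2^{m_1}+2^{m_2}+\cdots+2^{m_u}$, $m_1<m_2<\cdots<m_u$, be the $2$-adic representation of $n$. Let $W(T,R,J)$ be the group of $n\times n$ block diagonal matrices $\mathrm{diag}(a_1,\dots,a_u)$ with $a_i\in w_{m_i}(T,R,J)$. Let $U(R)=1$ if $u=1$; if $u\ge2$, let $U(R)$ be the group generated by the block diagonal matrices, for $r\in R$ and $1\le i\le u-1$, whose $i$-th and $(i+1)$-th blocks are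 $d_{m_i}(r)$ and $d_{m_{i+1}}(r)$ and whose $j$-th block is $I_{2^{m_j}}$ for $j\ne i,i+1$. Then $U(R)$ normalises $W(T,R,J)$ and $S(T,R,J)=W(T,R,J)\rtimes U(R)$.
   Formalization: The formal theorem assumes in addition that T is nontrivial; for T = R = 1 and n = 2 the group S is generated by the 2×2 swap matrix, so its 2-rank is 1 while the stated bound is 0. *)

(* Defs.v *)
From HB Require Import structures.
From mathcomp Require Import all_boot all_fingroup all_solvable.

Set Implicit Arguments.
Unset Strict Implicit.
Unset Printing Implicit Defensive.

Import GroupScope.

(* A monomial matrix with rows and columns indexed by a finite type I and
   nonzero entries in a group gT is stored as the pair (f, s) whose nonzero
   entry in row i is f i and lies in column s i.  [entry] recovers the matrix,
   with None for 0; [entry_inj], [entry_surj] and [entryM] say that monomial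
   matrices and their usual product are represented exactly. *)
Record monomial (gT : finGroupType) (I : finType) :=
  Monomial { mono_val : {ffun I -> gT} * {perm I} }.

HB.instance Definition _ (gT : finGroupType) (I : finType) :=
  [isNew for @mono_val gT I].
HB.instance Definition _ (gT : finGroupType) (I : finType) :=
  [Finite of monomial gT I by <:].

Section Monomial.

Variables (gT : finGroupType) (I : finType).
Implicit Types A B C : monomial gT I.

Definition coefm A : {ffun I -> gT} := (mono_val A).1.
Definition permm A : {perm I} := (mono_val A).2.

Definition mono_mul A B : monomial gT I :=
  Monomial ([ffun i => coefm A i * coefm B (permm A i)], permm A * permm B).
Definition mono_one : monomial gT I := Monomial ([ffun => 1], 1).
Definition mono_inv A : monomial gT I :=
  Monomial ([ffun i => (coefm A ((permm A)^-1 i))^-1], (permm A)^-1).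

Fact mono_mulA : associative mono_mul.
Proof.
move=> A B C; congr (Monomial (_, _)); last by rewrite /= mulgA.
by apply/ffunP=> i; rewrite !ffunE /= permM mulgA.
Qed.

Fact mono_mul1 : left_id mono_one mono_mul.
Proof.
case=> -[f s]; congr (Monomial (_, _)); last by rewrite mul1g.
by apply/ffunP=> i; rewrite !ffunE /= perm1 mul1g.
Qed.

Fact mono_mulV : left_inverse mono_one mono_inv mono_mul.
Proof.
case=> -[f s]; congr (Monomial (_, _)); last by rewrite /= mulVg.
by apply/ffunP=> i; rewrite !ffunE /= mulVg.
Qed.

HB.instance Definition _ :=
  Finite_isGroup.Build (monomial gT I) mono_mulA mono_mul1 mono_mulV.

Definition entry A (i j : I) : option gT :=
  if permm A i == j then Some (coefm A i) else None.

Lemma entry_inj A B : entry A =2 entry B -> A = B.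
Proof.
case: A B => -[f s] [[g t]] eqAB.
have eq_i i : s i = t i /\ f i = g i.
  move: (eqAB i (s i)); rewrite /entry /permm /coefm /= eqxx.
  by case: eqP => // -> [].
by congr (Monomial (_, _)); [apply/ffunP|apply/permP]=> i; case: (eq_i i).
Qed.

Lemma entry_surj (e : I -> I -> option gT) :
    (forall i, exists! j, e i j <> None) ->
    (forall j, exists! i, e i j <> None) ->
  exists A, entry A =2 e.
Proof.
move=> row col.
have rowb i : exists j, e i j != None.
  by have [j [/eqP eij _]] := row i; exists j.
pose t i := xchoose (rowb i).
have tP i : e i (t i) != None by apply: (xchooseP (rowb i)).
have t_inj : injective t.
  move=> i i' eq_t; have [k [_ uk]] := col (t i).
  rewrite -(uk i) -1?(uk i') //; apply/eqP; last exact: tP.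
  by rewrite eq_t tP.
exists (Monomial ([ffun i => odflt 1 (e i (t i))], perm t_inj)) => i j.
rewrite /entry /permm /coefm /= permE ffunE; case: eqP => [<-|nej].
  by case: (e i (t i)) (tP i).
case eij: (e i j) => [x|] //; case: nej.
have [k [_ uk]] := row i.
by rewrite -(uk (t i)) ?(uk j) ?eij //; apply/eqP; apply: tP.
Qed.

Lemma entryM A B i k z :
  entry (A * B) i k = Some z <->
  exists j x y, [/\ entry A i j = Some x, entry B j k = Some y & z = x * y].
Proof.
rewrite /entry [permm _]/= [coefm _]/= permM ffunE; split.
  case: eqP => // <- [<-]; exists (permm A i).
  by exists (coefm A i), (coefm B (permm A i)); rewrite !eqxx.
case=> j [x [y []]]; case: eqP => // <- [<-].
by case: eqP => // _ [<-] ->.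
Qed.

End Monomial.

Section BlockDiagonal.

Variables (gT : finGroupType).

Definition mono_diag (I : finType) (f : I -> gT) : monomial gT I :=
  Monomial ([ffun i => f i], 1).

Section Two.

Variables (I J : finType) (A : monomial gT I) (B : monomial gT J).

Definition block2_fun (x : I + J) : I + J :=
  match x with inl i => inl (permm A i) | inr j => inr (permm B j) end.

Fact block2_fun_inj : injective block2_fun.
Proof. by case=> x [] y //= [] /perm_inj->. Qed.

(* diag(A, B) *)
Definition mono_block2 : monomial gT (I + J)%type :=
  Monomial ([ffun x => match x with
                       | inl i => coefm A i
                       | inr j => coefm B j
                       end],
            perm block2_fun_inj).

End Two.

Section Swap.

Variable I : finType.

Definition swap_fun (x : I + I) : I + I :=
  match x with inl i => inr i | inr i => inl i end.

Fact swap_fun_inj : injective swap_fun.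
Proof. by apply: (can_inj (g := swap_fun)); case. Qed.

(* The permutation matrix with block rows (0, 1) and (1, 0). *)
Definition mono_swap : monomial gT (I + I)%type :=
  Monomial ([ffun => 1], perm swap_fun_inj).

End Swap.

Section Family.

Variables (u : nat) (I : 'I_u -> finType) (A : forall l, monomial gT (I l)).

Definition block_fun (x : {l : 'I_u & I l}) : {l : 'I_u & I l} :=
  Tagged I (permm (A (tag x)) (tagged x)).

Fact block_fun_inj : injective block_fun.
Proof.
case=> l x [l' y] /eqP; rewrite -tag_eqE /tag_eq /= => /andP[/eqP eql].
by subst l'; rewrite tagged_asE => /eqP/perm_inj->.
Qed.

(* diag(A_1, ..., A_u) *)
Definition mono_block : monomial gT {l : 'I_u & I l} :=
  Monomial ([ffun x => coefm (A (tag x)) (tagged x)], perm block_fun_inj).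

End Family.

End BlockDiagonal.

(* The 2^k indices of the rows of the matrices in w_k, arranged so that the
   two halves of a matrix of w_(k+1) are indexed by copies of the indices for
   w_k. *)
Fixpoint pow2_idx (k : nat) : finType :=
  if k is k'.+1 then (pow2_idx k' + pow2_idx k')%type else unit.

Fixpoint first_idx (k : nat) : pow2_idx k :=
  if k is k'.+1 return pow2_idx k then inl (first_idx k') else tt.

Lemma card_pow2_idx k : #|pow2_idx k| = (2 ^ k)%N.
Proof.
elim: k => [|k IHk]; first by rewrite card_unit.
by rewrite card_sum IHk addnn -mul2n -expnS.
Qed.

(* The n indices of the rows of the matrices in S(T, R, J), where
   n = \sum_(l < u) 2 ^ m l. *)
Definition binary_idx (u : nat) (m : 'I_u -> nat) : finType :=
  {l : 'I_u & pow2_idx (m l)}.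

Lemma card_binary_idx (u : nat) (m : 'I_u -> nat) :
  #|binary_idx m| = (\sum_(l < u) 2 ^ m l)%N.
Proof.
rewrite card_tagged sumnE big_map big_enum /=.
by apply: eq_bigr => l _; rewrite card_pow2_idx.
Qed.

Section Groups.

Variable gT : finGroupType.
Implicit Types T R : {set gT}.

Definition d_mx (k : nat) (r : gT) : monomial gT (pow2_idx k) :=
  mono_diag (fun x => if x == first_idx k then r else 1).

(* J is a fixed symbol in the notations w_k(T, R, J), W(T, R, J) and
   S(T, R, J): it does not occur in the definitions. *)
Fixpoint w_set T R (k : nat) : {set monomial gT (pow2_idx k)} :=
  match k return {set monomial gT (pow2_idx k)} with
  | 0 => [set d_mx 0 t | t in T]
  | k'.+1 =>
    <<[set mono_block2 a 1 | a in w_set T R k']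
      :|: [set mono_block2 1 a | a in w_set T R k']
      :|: [set mono_block2 (d_mx k' r) (d_mx k' r)^-1 | r in R]
      :|: [set mono_swap gT (pow2_idx k')]>>
  end.

Variables (u : nat) (m : 'I_u -> nat).

Definition W_set T R : {set monomial gT (binary_idx m)} :=
  [set mono_block a | a : {dffun forall l : 'I_u, monomial gT (pow2_idx (m l))}
                      & [forall l, a l \in w_set T R (m l)]].

(* Blocks are numbered from 0.  For u <= 1 the union is empty and the
   generated group is trivial. *)
Definition U_set R : {set monomial gT (binary_idx m)} :=
  <<\bigcup_(i < u.-1)
     [set mono_block (fun l : 'I_u =>
            if (l == i :> nat) || (l == i.+1 :> nat) then d_mx (m l) r else 1)
     | r in R]>>.

(* The product W U(R), written as the subgroup generated by W and U(R). *)
Definition S_group T R : {group monomial gT (binary_idx m)} :=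
  (W_set T R <*> U_set R)%G.

End Groups.

(* Main.v *)
Require Import Defs.
From mathcomp Require Import all_boot all_fingroup all_solvable ssralg zify.

Import GroupScope.

Set Implicit Arguments.
Unset Strict Implicit.
Unset Printing Implicit Defensive.

(** Let H = T ><| R and let E be an elementary abelian p-group of monomial
matrices over H.  If x is a row index with E-orbit O, then E is cut into three
pieces: the orbit itself, contributing log_p #|O|; the values at x of the
matrices fixing x, which form an elementary abelian subgroup of H and
contribute at most r(T) + r(R); and the subgroup K of matrices fixing x with
value 1 at x.  As E is abelian, K is trivial on the whole of O
([abelian_trivial_orbit]), so it lives on the remaining rows and induction
applies.  Since log_p #|O| < #|O| and r(T) > 0, an orbit costs at most
#|O| r(T) + r(R), which sums to at most n (r(T) + r(R)).

One copy of r(R) has to be saved, and it is saved at the last orbit.  If that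
orbit has at least two points, then r(R) <= (#|O| - 1) r(R) does it.  If it is
a single row x, every matrix left is diagonal with x as its only nontrivial
row, and it suffices that the value at x lies in T
([logn_abelem_monomial]).

That last fact comes from a determinant.  Reducing the entries of a matrix
modulo T and multiplying them in the abelian group H / T ~ R gives a
multiplicative invariant.  It is trivial on each w_k(T, R), and a generator of
U(R) has the same value r on two consecutive blocks.  Hence on S(T, R) the
product over the odd-numbered blocks equals the product over the
even-numbered ones ([S_group_balanced]); for a matrix with a single nontrivial
row this says that its value there is trivial modulo T
([balanced_single]). *)

(** * Rank of an elementary abelian group of monomial matrices *)

(** Contribution of an orbit of o rows with logarithm a: the slack a <= o - 1
is paid by o - 1 copies of t, leaving one t for the values at a row. *)
Lemma leq_orbit_rank a o t r l :
  (0 < t -> a < o -> l <= t + r -> a + l <= o * t + r)%N.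
Proof.
case: o => // o t_gt0; rewrite ltnS mulSn => leao lel.
have := leq_trans leao (leq_pmulr o t_gt0); lia.
Qed.

(** Adds an orbit of o rows to a bound for q rows in which one r has already
been saved. *)
Lemma leq_add_orbit_rank a k l o q t r :
  (0 < o -> 0 < q -> a + l <= o * t + r -> k <= q * t + (q - 1) * r ->
   a + k + l <= (o + q) * t + (o + q - 1) * r)%N.
Proof.
move=> o_gt0 q_gt0 leal lek; rewrite -addnBA // !mulnDl.
have := leq_pmull r o_gt0; lia.
Qed.

Section ElementaryAbelian.

Variables (gT : finGroupType) (I : finType).
Implicit Types (A B : monomial gT I) (E : {group monomial gT I}).

Lemma permmM A B : permm (A * B) = permm A * permm B. Proof. by []. Qed.

Lemma coefmM A B i : coefm (A * B) i = coefm A i * coefm B (permm A i).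
Proof. by rewrite [LHS]ffunE. Qed.

Lemma permm1 : permm (1 : monomial gT I) = 1. Proof. by []. Qed.

Lemma coefm1 i : coefm (1 : monomial gT I) i = 1.
Proof. by rewrite [LHS]ffunE. Qed.

Lemma mono_eq1 A :
  (forall i, permm A i = i /\ coefm A i = 1) -> A = 1.
Proof.
move=> A1; apply: entry_inj => i j.
by rewrite /entry permm1 perm1 coefm1; have [-> ->] := A1 i.
Qed.

Definition mono_act (i : I) A := permm A i.

Fact mono_act1 : mono_act^~ 1 =1 id.
Proof. by move=> i; rewrite /mono_act permm1 perm1. Qed.

Fact mono_actM i : act_morph mono_act i.
Proof. by move=> A B; rewrite /mono_act permmM permM. Qed.

Canonical mono_action := TotalAction mono_act1 mono_actM.

(** On the stabiliser of the row x, the entry of the row x is multiplicative. *)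
Definition coef_at x A := coefm A x.

Fact coef_atM x : {in 'C[x | mono_action] &, {morph coef_at x : A B / A * B}}.
Proof.
move=> A B /astab1P xA _; rewrite /coef_at coefmM; congr (_ * coefm B _).
exact: xA.
Qed.

Canonical coef_at_morphism x := Morphism (@coef_atM x).

(** Every row y of the orbit of x is x moved by some B in E, and comparing row
x in A * B and B * A transports the triviality of A from x to y. *)
Lemma abelian_trivial_orbit E A x y :
    abelian E -> A \in E -> permm A x = x -> coefm A x = 1 ->
  y \in orbit mono_action E x -> permm A y = y /\ coefm A y = 1.
Proof.
move=> abE EA xA A1 /orbitP[B EB <-]; rewrite /= /mono_act.
have cAB: A * B = B * A by apply: (centsP abE).
split; first by rewrite -permM -permmM -cAB permmM permM xA.
have /eqP := coefmM B A x; rewrite -cAB coefmM xA A1 mul1g.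
by rewrite -{1}[coefm B x]mulg1 (inj_eq (mulgI _)) => /eqP.
Qed.

(** The number r stands for the rank of a quotient of H by T.  The set X, a
set of rows outside which E is trivial, is what shrinks in the induction; the
last hypothesis is what saves one r when a single row is left. *)
Lemma logn_abelem_monomial p (T H : {group gT}) r E (X : {set I}) :
    prime p -> (0 < 'r_p(T))%N -> ('r_p(H) <= 'r_p(T) + r)%N ->
    p.-abelem E -> X != set0 ->
    (forall A i, A \in E -> coefm A i \in H) ->
    (forall A i, A \in E -> i \notin X -> permm A i = i /\ coefm A i = 1) ->
    (forall A x, A \in E ->
       (forall i, i != x -> permm A i = i /\ coefm A i = 1) ->
     coefm A x \in T) ->
  (logn p #|E| <= #|X| * 'r_p(T) + (#|X| - 1) * r)%N.
Proof.
move=> p_pr T_gt0 rH; move: {2}_.+1 (ltnSn #|X|) => N.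
elim: N E X => // N IHN E X; rewrite ltnS => leXN abE /set0Pn[x Xx] EH EX ET.
have pE := abelem_pgroup abE; have cE := abelem_abelian abE.
pose O := orbit mono_action E x; pose C := 'C_E[x | mono_action]%G.
pose K := (C :&: 'ker (coef_at_morphism x))%G.
pose L := (coef_at_morphism x @* C)%G.
have sKE: K \subset E := subset_trans (subsetIl _ _) (subsetIl _ _).
have cardE: #|E| = (#|O| * (#|K| * #|L|))%N.
  rewrite -(card_orbit_stab mono_action E x).
  rewrite -(LagrangeI C ('ker (coef_at_morphism x))).
  by rewrite card_morphim (setIidPr (subsetIr _ _)).
have Ox: x \in O by apply: orbit_refl.
have O_gt0: (0 < #|O|)%N by rewrite (cardD1 x) Ox.
(* If A moved a row of X outside X it would send two rows to the same one. *)
have sOX: O \subset X.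
  apply/subsetP=> _ /orbitP[A EA <-]; rewrite /= /mono_act.
  apply: contraLR Xx => nX; have [eqA _] := EX A _ EA nX.
  by rewrite -(perm_inj eqA).
have KO A i : A \in K -> i \in O -> permm A i = i /\ coefm A i = 1.
  case/setIP=> /setIP[EA /astab1P xA] /morphpreP[_ /set1P A1].
  exact: abelian_trivial_orbit.
have abL: p.-abelem L by rewrite morphim_abelem // (abelemS _ abE) ?subsetIl.
have rankL (G : {group gT}) : L \subset G -> (logn p #|L| <= 'r_p(G))%N.
  by move=> sLG; apply: logn_le_p_rank; apply/pElemP.
have sLH: L \subset H.
  by apply/subsetP=> _ /morphimP[A _ /setIP[EA _] ->]; apply: EH.
have logO: (logn p #|O| < #|O|)%N.
  have /p_natP[a Oa]: p.-nat #|O|.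
    by apply: pnat_dvd pE; rewrite cardE dvdn_mulr.
  by rewrite Oa pfactorK // ltn_expl // prime_gt1.
have logE: (logn p #|E| = logn p #|O| + logn p #|K| + logn p #|L|)%N.
  by rewrite cardE !lognM ?muln_gt0 ?cardG_gt0 ?addnA.
have cardX := cardsID O X; rewrite (setIidPr sOX) in cardX.
have [XO0 | XO_n0] := eqVneq (X :\: O) set0.
  have eqXO: X = O.
    by apply/eqP; rewrite eqEsubset sOX andbT -setD_eq0 XO0.
  have K1: #|K| = 1%N.
    suffices /trivgP->: K \subset [1] by rewrite cards1.
    apply/subsetP=> A KA; apply/set1P/mono_eq1 => i; have [Oi|nOi] := boolP (i \in O).
      exact: KO KA Oi.
    by apply: EX; rewrite ?eqXO // (subsetP sKE).
  rewrite logE K1 logn1 addn0 eqXO.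
  have [O1 | O_gt1] := leqP #|O| 1.
    have sLT: L \subset T.
      apply/subsetP=> _ /morphimP[A _ /setIP[EA _] ->].
      apply: ET => // i ne_ix; apply: EX; rewrite // eqXO.
      apply: contra ne_ix => Oi; apply/eqP.
      by apply: (card_le1_eqP O1).
    (* A single row left: the values lie in T, so no r is needed. *)
    apply: leq_trans (leq_addr _ _); rewrite -[leqRHS]addn0.
    by apply: leq_orbit_rank; rewrite // addn0 rankL.
  have O1_gt0: (0 < #|O| - 1)%N by rewrite subn_gt0.
  apply: leq_trans (leq_orbit_rank T_gt0 logO (leq_trans (rankL _ sLH) rH)) _.
  by rewrite leq_add2l leq_pmull.
have rankK: (logn p #|K| <= #|X :\: O| * 'r_p(T) + (#|X :\: O| - 1) * r)%N.
  apply: IHN => //.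
  - by apply: leq_trans leXN; rewrite -cardX -[ltnLHS]add0n ltn_add2r.
  - exact: abelemS abE.
  - by move=> A i /(subsetP sKE); apply: EH.
  - move=> A i KA; rewrite inE negb_and negbK => /orP[|nX]; first exact: KO.
    by apply: EX; rewrite // (subsetP sKE).
  by move=> A y /(subsetP sKE); apply: ET.
have XO_gt0: (0 < #|X :\: O|)%N by rewrite card_gt0.
rewrite logE -cardX; apply: leq_add_orbit_rank => //.
exact: leq_orbit_rank T_gt0 logO (leq_trans (rankL _ sLH) rH).
Qed.

End ElementaryAbelian.

(** * Determinants modulo T *)

Import GRing.Theory FiniteModule.

Section Determinant.

Variables (gT : finGroupType) (T H : {group gT}).
Hypotheses (sTH : T \subset H) (nTH : H \subset 'N(T)).
Hypothesis abHT : abelian (H / T).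

(** The abelian group H / T is written additively, so that determinants are
sums over unordered index types. *)
Definition coset_val x : fmod_of abHT := fmod abHT (coset T x).

Lemma coset_valM : {in H &, {morph coset_val : x y / x * y >-> (x + y)%R}}.
Proof.
move=> x y Hx Hy; rewrite /coset_val morphM ?(subsetP nTH) //.
by rewrite fmodM ?mem_quotient.
Qed.

Lemma coset_val_id x : x \in T -> coset_val x = 0%R.
Proof. by move=> Tx; rewrite /coset_val coset_id // fmod1. Qed.

Lemma coset_valV x : x \in H -> coset_val x^-1 = (- coset_val x)%R.
Proof. by move=> Hx; rewrite /coset_val morphV ?(subsetP nTH) // fmodV. Qed.

Lemma coset_val_eq0 x : x \in H -> coset_val x = 0%R -> x \in T.
Proof.
move=> Hx; rewrite /coset_val => x0; apply: coset_idr; first exact: (subsetP nTH).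
by rewrite -(fmodK abHT (mem_quotient T Hx)) x0.
Qed.

(** The determinant modulo T of the rows satisfying c. *)
Definition part_det (I : finType) (c : pred I) (A : monomial gT I) :=
  (\sum_(i | c i) coset_val (coefm A i))%R.

(** Equating the two partial determinants replaces the alternating product of
block determinants. *)
Definition balanced (I : finType) (c : pred I) : {set monomial gT I} :=
  [set A | [&& [forall i, coefm A i \in H], [forall i, c (permm A i) == c i]
             & part_det c A == part_det (predC c) A]].

Lemma balancedP (I : finType) (c : pred I) A :
  reflect [/\ forall i, coefm A i \in H, forall i, c (permm A i) = c i
            & part_det c A = part_det (predC c) A]
          (A \in balanced c).
Proof.
rewrite inE; apply: (iffP and3P) => [[/forallP AH /forallP Ac /eqP Ad]|[AH Ac Ad]].
  by split=> // i; apply/eqP.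
by split; [apply/forallP|apply/forallP=> i; apply/eqP|apply/eqP].
Qed.

(** The rows of B are met in the order given by A, which permutes the rows
satisfying c. *)
Lemma part_detM (I : finType) (c : pred I) (A B : monomial gT I) :
    (forall i, coefm A i \in H) -> (forall i, coefm B i \in H) ->
    (forall i, c (permm A i) = c i) ->
  part_det c (A * B) = (part_det c A + part_det c B)%R.
Proof.
move=> AH BH Ac; rewrite {3}/part_det (reindex_inj (@perm_inj _ (permm A))).
rewrite (eq_bigl c) // -big_split /=; apply: eq_bigr => i _.
by rewrite coefmM coset_valM.
Qed.

Fact balanced_group_set (I : finType) (c : pred I) : group_set (balanced c).
Proof.
apply/group_setP; split=> [|A B /balancedP[AH Ac Ad] /balancedP[BH Bc Bd]].
  apply/balancedP; split=> [i|i|]; rewrite ?coefm1 ?permm1 ?perm1 //.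
  by rewrite /part_det !big1 // => i _; rewrite coefm1 coset_val_id.
apply/balancedP; split=> [i|i|].
- by rewrite coefmM groupM.
- by rewrite permmM permM Bc.
by rewrite !part_detM ?Ad ?Bd // => i; rewrite /= Ac.
Qed.

Canonical balanced_group (I : finType) (c : pred I) :=
  Group (balanced_group_set c).

(** One of the two partial determinants is empty of nontrivial entries, so the
other one, which is the entry at x modulo T, vanishes. *)
Lemma balanced_single (I : finType) (c : pred I) A x :
    A \in balanced c -> (forall i, i != x -> permm A i = i /\ coefm A i = 1) ->
  coefm A x \in T.
Proof.
case/balancedP=> AH _ Ad A1; apply: coset_val_eq0 => //.
have dE (d : pred I) :
    part_det d A = if d x then coset_val (coefm A x) else 0%R.
  rewrite /part_det big_mkcond (bigD1 x) //= big1 ?addr0 // => i /A1[_ ->].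
  by rewrite coset_val_id // if_same.
by move: Ad; rewrite !dE /=; case: (c x).
Qed.

Lemma p_rank_balanced p (I : finType) (c : pred I) (G : {group monomial gT I}) :
    prime p -> (0 < 'r_p(T))%N -> (0 < #|I|)%N -> G \subset balanced c ->
  ('r_p(G) <= #|I| * 'r_p(T) + (#|I| - 1) * 'r_p(H / T))%N.
Proof.
move=> p_pr T_gt0 I_gt0 sGB.
have [E /pnElemP[sEG abE <-]] := p_rank_witness p G.
have sEB := subset_trans sEG sGB; rewrite -cardsT in I_gt0 *.
apply: (@logn_abelem_monomial _ _ p T H) => //.
- by rewrite -leq_subLR p_rank_quotient.
- by rewrite -card_gt0.
- by move=> A i /(subsetP sEB)/balancedP[].
- by move=> A i _; rewrite inE.
by move=> A x /(subsetP sEB); apply: balanced_single.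
Qed.

(** * The generators of S(T, R) *)

Section Generators.

Variable R : {group gT}.
Hypothesis sRH : R \subset H.

Lemma coefm_d_mx k (r : gT) x : coefm (d_mx k r) x = if x == first_idx k then r else 1.
Proof. by rewrite [LHS]ffunE. Qed.

Lemma mem_coefm_d_mx (G : {group gT}) k r (x : pow2_idx k) :
  r \in G -> coefm (d_mx k r) x \in G.
Proof. by move=> Gr; rewrite coefm_d_mx; case: ifP. Qed.

Lemma d_mxV k (r : gT) : (d_mx k r)^-1 = d_mx k r^-1.
Proof.
apply: (mulgI (d_mx k r)); rewrite mulgV; apply/esym/mono_eq1=> x.
rewrite permmM permM !perm1 coefmM perm1 !coefm_d_mx.
by case: ifP; rewrite ?mulgV ?mulg1.
Qed.

Lemma sum_d_mx k (r : gT) :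
  (\sum_x coset_val (coefm (d_mx k r) x))%R = coset_val r.
Proof.
rewrite (bigD1 (first_idx k)) //= coefm_d_mx eqxx big1 ?addr0 // => x ne_x.
by rewrite coefm_d_mx (negPf ne_x) coset_val_id.
Qed.

(** With a constant condition one of the partial determinants is empty, so
being balanced means having determinant zero. *)
Definition unimodular (I : finType) := @balanced I xpredT.

Lemma unimodularP (I : finType) A :
  reflect ((forall i, coefm A i \in H) /\
           (\sum_i coset_val (coefm A i))%R = 0%R)
          (A \in unimodular I).
Proof.
have det0: part_det (predC xpredT) A = 0%R by apply: big_pred0.
by apply: (iffP (balancedP _ _)); rewrite det0 => -[].
Qed.

Lemma block2_unimodular (I J : finType) (A : monomial gT I) (B : monomial gT J) :
    (forall i, coefm A i \in H) -> (forall j, coefm B j \in H) ->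
    ((\sum_i coset_val (coefm A i)) + (\sum_j coset_val (coefm B j)) = 0)%R ->
  mono_block2 A B \in unimodular (I + J)%type.
Proof.
move=> AH BH AB0; apply/unimodularP; split=> [x|].
  by rewrite [coefm _ _]ffunE; case: x.
rewrite -[RHS]AB0 big_sumType; congr (_ + _)%R.
  by apply: eq_bigr => i _; rewrite [coefm (mono_block2 _ _) _]ffunE.
by apply: eq_bigr => i _; rewrite [coefm (mono_block2 _ _) _]ffunE.
Qed.

Lemma w_set_unimodular k : w_set T R k \subset unimodular (pow2_idx k).
Proof.
elim: k => [|k IHk].
  apply/subsetP=> _ /imsetP[t Tt ->]; apply/unimodularP; split=> [i|].
    exact: (mem_coefm_d_mx (k := 0)) (subsetP sTH t Tt).
  by rewrite (sum_d_mx 0) coset_val_id.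
have one_sum (I : finType) :
    (\sum_i coset_val (coefm (1%g : monomial gT I) i))%R = 0%R.
  by apply: big1 => i _; rewrite coefm1 coset_val_id.
rewrite /= gen_subG !subUset -!andbA; apply/and4P; split.
- apply/subsetP=> _ /imsetP[a /(subsetP IHk)/unimodularP[aH a0] ->].
  by apply: block2_unimodular => // [j|]; rewrite ?coefm1 // one_sum a0 addr0.
- apply/subsetP=> _ /imsetP[a /(subsetP IHk)/unimodularP[aH a0] ->].
  by apply: block2_unimodular => // [j|]; rewrite ?coefm1 // one_sum a0 addr0.
- apply/subsetP=> _ /imsetP[r /(subsetP sRH) Hr ->]; rewrite d_mxV.
  apply: block2_unimodular => [i|i|].
  + exact: mem_coefm_d_mx.
  + by rewrite mem_coefm_d_mx ?groupV.
  by rewrite !sum_d_mx coset_valV // subrr.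
rewrite sub1set; apply/unimodularP; split=> [i|]; first by rewrite [coefm _ _]ffunE.
by apply: big1 => i _; rewrite [coefm _ _]ffunE coset_val_id.
Qed.

Variables (u : nat) (m : 'I_u -> nat).

Definition odd_block (x : binary_idx m) := odd (tag x).

Lemma sum_mono_block (d : pred 'I_u) (a : forall l, monomial gT (pow2_idx (m l))) :
  part_det (fun x : binary_idx m => d (tag x)) (mono_block a)
    = (\sum_(l | d l) \sum_x coset_val (coefm (a l) x))%R.
Proof.
rewrite /part_det sig_big_dep; apply: eq_big => [x|x _]; first by rewrite andbT.
by rewrite [coefm (mono_block _) _]ffunE.
Qed.

Lemma block_balanced (a : forall l, monomial gT (pow2_idx (m l))) :
    (forall l x, coefm (a l) x \in H) ->
    (\sum_(l : 'I_u | odd l) \sum_x coset_val (coefm (a l) x) =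
     \sum_(l : 'I_u | ~~ odd l) \sum_x coset_val (coefm (a l) x))%R ->
  mono_block a \in balanced odd_block.
Proof.
move=> aH a_bal; apply/balancedP; split=> [x|x|].
- by rewrite [coefm _ _]ffunE.
- by rewrite [permm _]/= permE.
by rewrite (sum_mono_block (fun l => odd l)) (sum_mono_block (fun l => ~~ odd l)).
Qed.

(** Blocks of W have determinant zero, and a generator of U(R) changes the
determinants of two consecutive blocks, one of each parity, by the same
amount. *)
Lemma S_group_balanced : S_group m T R \subset balanced odd_block.
Proof.
rewrite gen_subG subUset; apply/andP; split.
  apply/subsetP=> A /imsetP[a]; rewrite inE => /forallP wa ->{A}.
  have aP l := unimodularP _ (subsetP (w_set_unimodular (m l)) _ (wa l)).
  apply: block_balanced => [l x|]; first by have [] := aP l.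
  by rewrite !big1 // => l _; have [] := aP l.
rewrite gen_subG; apply/bigcupsP=> i _.
apply/subsetP=> _ /imsetP[r /(subsetP sRH) Hr ->].
pose s l := (l == i :> nat) || (l == i.+1 :> nat).
have i1_u : (i.+1 < u)%N by rewrite -ltn_predRL.
have i_u := ltnW i1_u.
have sumE b : (\sum_(l : 'I_u | odd l == b)
      \sum_x coset_val (coefm (if s l then d_mx (m l) r else 1%g) x) =
    coset_val r)%R.
  (* The block of parity b among the blocks i and i + 1. *)
  pose j := if odd i == b then Ordinal i_u else Ordinal i1_u.
  have sj : s j by rewrite /s /j; case: ifP; rewrite /= eqxx ?orbT.
  have oj : odd j == b by rewrite /j; case: ifPn => //= {j sj}; case: (odd i) b => -[].
  rewrite (bigD1 j) //= sj sum_d_mx big1 ?addr0 // => l /andP[/eqP ol ne_lj].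
  have -> : s l = false.
    apply: contraNF ne_lj; rewrite /j -ol.
    case/orP=> /eqP l_i; apply/eqP/val_inj; rewrite /= !l_i ?eqxx //=.
    by case: (odd i).
  by apply: big1 => x _; rewrite coefm1 coset_val_id.
apply: block_balanced => [l x|].
  by case: ifP => _; rewrite ?coefm1 // mem_coefm_d_mx.
rewrite [LHS](eq_bigl (fun l : 'I_u => odd l == true)) => [|l]; last by case: odd.
rewrite [RHS](eq_bigl (fun l : 'I_u => odd l == false)) => [|l]; last by case: odd.
by rewrite !sumE.
Qed.

End Generators.
End Determinant.

Theorem lemma4p6 (gT : finGroupType) (T R TR : {group gT})
    (n u : nat) (m : 'I_u -> nat)
    (defTR : T ><| R = TR)
    (pT : 2.-group T) (pR : 2.-group R) (abR : abelian R)
    (ntT : T :!=: 1)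
    (n_ge1 : (1 <= n)%N)
    (m_incr : forall i j : 'I_u, (i < j)%N -> (m i < m j)%N)
    (def_n : n = (\sum_(i < u) 2 ^ m i)%N) :
  ('r_2(S_group m T R) <= n * 'r_2(T) + (n - 1) * 'r_2(R))%N.
Proof.
have [/andP[sTH nTH] sRH _ _ _] := sdprod_context defTR.
have isoR := sdprod_isog defTR.
have abQ : abelian (TR / T) by rewrite -(isog_abelian isoR).
have T_gt0 : (0 < 'r_2(T))%N.
  by rewrite p_rank_gt0 -p_rank_gt0 -(rank_pgroup pT) rank_gt0.
rewrite (isog_p_rank isoR) def_n -(card_binary_idx m).
apply: p_rank_balanced (S_group_balanced sTH nTH abQ sRH m) => //.
by rewrite card_binary_idx -def_n.
Qed.
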